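(* Let $K$ be a field and $n\geq 3$. Let $X_n$ be the $n\times n$ generic alternating matrix over the polynomial ring $K[x_{ij},\,y_k \mid 1\leq i<j\leq n,\ 1\leq k\leq n]$, i.e. its $(i,j)$ entry is the indeterminate $x_{ij}$ for $i<j$, $x_{ij}=-x_{ji}$ for $i>j$, and $x_{ii}=0$; and let $Y_n=(y_1,\ldots,y_n)^T$. For $1\leq k\leq n$ let $g_{kn}=\sum_{j=1}^n x_{kj}y_j$ (the $k$-th entry of $X_nY_n$). Then $g_{1n},\ldots,g_{(n-1)n},g_{nn}$ is a $d$-sequence.
   Context: A sequence $a_1,\ldots,a_m$ of elements of a commutative ring $A$ is a $d$-sequence if, setting $a_0=0$, one has $(\langle a_0,\ldots,a_i\rangle : a_{i+1}a_j)=(\langle a_0,\ldots,a_i\rangle : a_j)$ for all $0\leq i\leq m-1$ and all $i+1\leq j\leq m$. *)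

(* Defs.v *)
From HB Require Import structures.
From mathcomp Require Import all_boot all_order all_algebra.
From mathcomp Require Import mpoly.

Set Implicit Arguments.
Unset Strict Implicit.
Unset Printing Implicit Defensive.

Import GRing.Theory.
Local Open Scope ring_scope.

Section DSequence.
Variable A : comNzRingType.

Definition ideal_gen (s : seq A) (x : A) : Prop :=
  exists c : 'I_(size s) -> A, x = \sum_(i < size s) c i * s`_i.

Definition colon (I : A -> Prop) (b : A) (x : A) : Prop := I (x * b).

(* The sequence a_1, ..., a_m is [s]; prepending 0 gives a_0 = 0, so that
   [take i.+1 a] lists a_0, ..., a_i. *)
Definition d_sequence (s : seq A) : Prop :=
  let a := 0 :: s in
  forall i j : nat, (i < size s)%N -> (i < j <= size s)%N ->
  forall x : A,
    colon (ideal_gen (take i.+1 a)) (a`_i.+1 * a`_j) x <->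
    colon (ideal_gen (take i.+1 a)) a`_j x.

End DSequence.

(* Index set of the indeterminates: [inl] of a pair i < j for x_ij, and
   [inr k] for y_k. *)
Definition vars (n : nat) : finType :=
  ({p : 'I_n * 'I_n | (p.1 < p.2)%N} + 'I_n)%type.

Section GenericAlternating.
Variables (K : fieldType) (n : nat).

Local Notation polyring := {mpoly K[#|vars n|]}.

Definition indet (v : vars n) : polyring := 'X_(enum_rank v).

(* The value 0 is junk: [xvar i j] is only used when i < j. *)
Definition xvar (i j : 'I_n) : polyring :=
  if insub (i, j) is Some p then indet (inl p) else 0.

Definition generic_alt_mx : 'M[polyring]_n :=
  \matrix_(i, j) if (i < j)%N then xvar i j
                 else if (j < i)%N then - xvar j i else 0.

Definition generic_col : 'cV[polyring]_n := \col_k indet (inr k).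

Definition g (k : 'I_n) : polyring :=
  \sum_(j < n) generic_alt_mx k j * generic_col j 0.

End GenericAlternating.

(* Main.v *)
(** Give x_(k,k+1) weight k + 1 and every other indeterminate weight 1, and order
monomials by weighted degree, breaking ties by a fixed monomial order.  For
k < n the leading monomial of g_k is then x_(k,k+1) y_(k+1); these monomials
are squarefree and pairwise coprime.  Coprimality makes g_1, ..., g_(n-1) a
regular sequence and every initial segment a Groebner basis; squarefreeness
then makes the ideal I = <g_1, ..., g_(n-1)> radical.  Regularity gives the
d-sequence condition at all steps but the last, where j = n and x g_n^2 in I
forces (x g_n)^2, hence x g_n, into I. *)
Require Import Defs.
From mathcomp Require Import all_boot all_order all_algebra.
From mathcomp Require Import mpoly.

Set Implicit Arguments.
Unset Strict Implicit.
Unset Printing Implicit Defensive.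

Import Order.TTheory GRing.Theory.
Local Open Scope ring_scope.

(** * Finitely generated ideals *)

Section IdealGen.
Variable A : comNzRingType.
Implicit Types (s : seq A) (a p x y : A).

Lemma ideal_gen0 s : ideal_gen s 0.
Proof. by exists (fun=> 0); rewrite big1 // => i _; rewrite mul0r. Qed.

Lemma ideal_genD s x y : ideal_gen s x -> ideal_gen s y -> ideal_gen s (x + y).
Proof.
move=> [c ->] [d ->]; exists (fun i => c i + d i).
by rewrite -big_split; apply: eq_bigr => i _; rewrite mulrDl.
Qed.

Lemma ideal_genM s a x : ideal_gen s x -> ideal_gen s (a * x).
Proof.
move=> [c ->]; exists (fun i => a * c i).
by rewrite mulr_sumr; apply: eq_bigr => i _; rewrite mulrA.
Qed.

Lemma ideal_genN s x : ideal_gen s x -> ideal_gen s (- x).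
Proof. by rewrite -mulN1r; apply: ideal_genM. Qed.

Lemma ideal_gen_mem s p : p \in s -> ideal_gen s p.
Proof.
move=> sp; have lt_p : (index p s < size s)%N by rewrite index_mem.
exists (fun i => (i == Ordinal lt_p)%:R).
rewrite (bigD1 (Ordinal lt_p)) //= eqxx mul1r nth_index // big1 ?addr0 // => i.
by move/negPf->; rewrite mul0r.
Qed.

Lemma ideal_gen_nil x : ideal_gen [::] x -> x = 0.
Proof. by case=> c ->; rewrite big_ord0. Qed.

Lemma ideal_gen_rcons s p x :
  ideal_gen (rcons s p) x -> exists a, ideal_gen s (x - a * p).
Proof.
case=> c ->; move: c; rewrite size_rcons => c.
exists (c ord_max); rewrite big_ord_recr /= nth_rcons ltnn eqxx addrK.
exists (fun i => c (widen_ord (leqnSn _) i)).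
by apply: eq_bigr => i _; rewrite nth_rcons ltn_ord.
Qed.

Lemma ideal_gen_cons0 s x : ideal_gen (0 :: s) x <-> ideal_gen s x.
Proof.
split=> [[c ->]|[c ->]].
  exists (fun i => c (lift ord0 i)).
  by rewrite big_ord_recl mulr0 add0r; apply: eq_bigr.
exists (fun i => if unlift ord0 i is Some j then c j else 0).
rewrite big_ord_recl mulr0 add0r; apply: eq_bigr => i _.
by rewrite liftK.
Qed.

End IdealGen.

(** * Weighted leading monomials, division and Groebner bases *)

Section WeightedLeadingMonomials.
Variables (K : fieldType) (n : nat) (w : 'I_n -> nat).
Implicit Types (m : 'X_{1..n}) (f p q : {mpoly K[n]}) (s : seq {mpoly K[n]}).

Definition scale m : 'X_{1..n} := [multinom ((w i).+1 * m i)%N | i < n].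

(* Raising each variable to the power [w i + 1] turns the weighted degree into
   the degree, hence pulls the library's degree-lexicographic order back to the
   weighted-degree order. *)
Definition weigh p := p \mPo [tuple 'X_i ^+ (w i).+1 | i < n].

Definition wlm p : 'X_{1..n} :=
  [multinom (mlead (weigh p) i %/ (w i).+1)%N | i < n].

Lemma scaleD m1 m2 : scale (m1 + m2) = (scale m1 + scale m2)%MM.
Proof. by apply/mnmP => i; rewrite !mnmE mulnDr. Qed.

Lemma scale_inj : injective scale.
Proof.
move=> m1 m2 /mnmP eq12; apply/mnmP => i; move/eqP: (eq12 i).
by rewrite !mnmE eqn_pmul2l // => /eqP.
Qed.

Lemma weighX m : weigh 'X_[m] = 'X_[scale m].
Proof.
rewrite /weigh comp_mpolyX [RHS]mpolyXE_id.
by apply: eq_bigr => i _; rewrite tnth_mktuple mnmE exprM.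
Qed.

Lemma weighM p q : weigh (p * q) = weigh p * weigh q.
Proof. exact: rmorphM. Qed.

Lemma weighE p : weigh p = \sum_(m <- msupp p) p@_m *: 'X_[scale m].
Proof.
rewrite /weigh comp_mpolyEX; apply: eq_bigr => m _.
by rewrite -weighX.
Qed.

Lemma mcoeff_weigh p m : (weigh p)@_(scale m) = p@_m.
Proof.
rewrite weighE [in RHS](mpolyE p) !raddf_sum /=; apply: eq_bigr => m' _.
by rewrite !mcoeffZ !mcoeffX (inj_eq scale_inj).
Qed.

Lemma weigh_eq0 p : (weigh p == 0) = (p == 0).
Proof.
apply/eqP/eqP => [wp0|->]; last exact: comp_mpoly0.
by apply/mpolyP => m; rewrite -mcoeff_weigh wp0 !mcoeff0.
Qed.

(** Every monomial occurring in [weigh p] is some [scale m], so the divisions in [wlm] are exact. *)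
Lemma mlead_weigh p : mlead (weigh p) = scale (wlm p).
Proof.
apply/mnmP => i; rewrite !mnmE mulnC divnK //.
have [->|p0] := eqVneq p 0; first by rewrite /weigh comp_mpoly0 mlead0 mnm0E.
have : mlead (weigh p) \in msupp (weigh p) by rewrite mlead_supp ?weigh_eq0.
set l := mlead _; rewrite mcoeff_msupp weighE raddf_sum /=.
have [/hasP[m _ /eqP <-] _|/hasPn nh] :=
    boolP (has (fun m => scale m == l) (msupp p)).
  by rewrite mnmE dvdn_mulr.
rewrite big_seq big1 ?eqxx // => m /nh /negPf.
by rewrite mcoeffZ mcoeffX => ->; rewrite mulr0.
Qed.

Lemma wlmM p q : p != 0 -> q != 0 -> wlm (p * q) = (wlm p + wlm q)%MM.
Proof.
move=> p0 q0; apply: scale_inj.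
by rewrite scaleD -!mlead_weigh weighM mleadM ?weigh_eq0.
Qed.

Lemma wlmD_neq p q :
  wlm p != wlm q -> wlm (p + q) = wlm p \/ wlm (p + q) = wlm q.
Proof.
rewrite -(inj_eq scale_inj) -!mlead_weigh neq_lt => /orP[] lt_pq.
  right; apply: scale_inj.
  by rewrite -!mlead_weigh /weigh comp_mpolyD mleadDr.
left; apply: scale_inj.
by rewrite -!mlead_weigh /weigh comp_mpolyD mleadDl.
Qed.

(** One division step: [a] is the term for which [a * p] and [f] have the same leading term. The
    remainder 0 is kept apart because [mlead 0] is the monomial 1, which is not strictly below the
    leading monomial of a constant. *)
Lemma wlm_cancel f p : f != 0 -> p != 0 -> (wlm p <= wlm f)%MM ->
  exists a, f - a * p = 0 \/
    (mlead (weigh (f - a * p)) < mlead (weigh f))%O.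
Proof.
move=> f0 p0 le_pf.
have wp0 : weigh p != 0 by rewrite weigh_eq0.
have cp0 : mleadc (weigh p) != 0 by rewrite mleadc_eq0.
pose a : {mpoly K[n]} :=
  (mleadc (weigh f) / mleadc (weigh p)) *: 'X_[wlm f - wlm p].
have weigha : weigh a =
    (mleadc (weigh f) / mleadc (weigh p)) *: 'X_[scale (wlm f - wlm p)].
  by rewrite /weigh comp_mpolyZ -/(weigh _) weighX.
have a0 : a != 0.
  rewrite -weigh_eq0 weigha -mleadc_eq0 mleadcZE mulf_neq0 //.
    by rewrite mulf_neq0 ?invr_eq0 // mleadc_eq0 weigh_eq0.
  by rewrite mleadXm mcoeffX eqxx oner_neq0.
have lead_ap : mlead (weigh (a * p)) = mlead (weigh f).
  rewrite !mlead_weigh wlmM // -[in RHS](submK le_pf); congr (scale (_ + _)).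
  apply: scale_inj; rewrite -mlead_weigh weigha mleadZ ?mleadXm //.
  by rewrite mulf_neq0 ?invr_eq0 // mleadc_eq0 weigh_eq0.
exists a; have [->|fap0] := eqVneq (f - a * p) 0; [by left | right].
set h := weigh (f - a * p).
have hE : h = weigh f - weigh (a * p) by exact: comp_mpolyB.
have h0 : h != 0 by rewrite weigh_eq0.
rewrite lt_neqAle; apply/andP; split; last first.
  by rewrite hE (le_trans (mleadB_le _ _)) // lead_ap joinxx.
apply: contraNneq h0 => lead_h; rewrite -mleadc_eq0 lead_h hE mcoeffB.
rewrite -[X in _ - _@_X]lead_ap weighM mleadM ?weigh_eq0 // mleadcM.
by rewrite weigha mleadcZE mleadXm mcoeffX eqxx mulr1 divfK ?subrr.
Qed.

Definition wreduced s f := forall p, p \in s -> ~~ (wlm p <= wlm f)%MM.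

(** Iterate [wlm_cancel], by well-founded induction on the leading monomial. Division stops once the
    leading monomial is irreducible; lower terms are left alone. *)
Lemma wreduce s f : 0 \notin s ->
  exists r, ideal_gen s (f - r) /\ (r = 0 \/ wreduced s r).
Proof.
move=> s0; have [m] : exists m, m = mlead (weigh f) by exists (mlead (weigh f)).
elim/(ltmwf (n := n)): m f => m IH f mE.
have [->|f0] := eqVneq f 0.
  by exists 0; split; [rewrite subr0; apply: ideal_gen0 | left].
have [/hasP[p sp le_pf]|/hasPn red_f] :=
    boolP (has (fun p => wlm p <= wlm f)%MM s); last first.
  by exists f; split; [rewrite subrr; apply: ideal_gen0 | right].
have p0 : p != 0 by apply: contraNneq s0 => <-.
have [a hfap] := wlm_cancel f0 p0 le_pf.
have sap : ideal_gen s (a * p) by apply/ideal_genM/ideal_gen_mem.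
case: hfap => [/eqP|lt_fap].
  by rewrite subr_eq0 => /eqP ->; exists 0; rewrite subr0; split; [|left].
rewrite -mE in lt_fap; have [r [fap_r red_r]] := IH _ lt_fap _ erefl.
exists r; split=> //; have -> : f - r = (f - a * p - r) + a * p.
  by rewrite addrAC subrK.
exact: ideal_genD.
Qed.

Definition groebner s :=
  forall f, ideal_gen s f -> f != 0 -> exists2 p, p \in s & (wlm p <= wlm f)%MM.

Definition coprime_mnm m1 m2 := [forall i, (m1 i == 0%N) || (m2 i == 0%N)].

Lemma coprime_mnm_le m1 m2 m :
  coprime_mnm m1 m2 -> (m1 <= m + m2)%MM -> (m1 <= m)%MM.
Proof.
move=> /forallP co12 /mnm_lepP le; apply/mnm_lepP => i; move: (le i).
by rewrite mnmDE; case/orP: (co12 i) => /eqP ->; rewrite ?addn0.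
Qed.

(** If the remainder [r] of [a] were nonzero, some [wlm p] would divide the leading monomial of
    [r * q], hence by coprimality that of [r], which is reduced. *)
Lemma groebner_nzd s q a : groebner s -> 0 \notin s -> q != 0 ->
  {in s, forall p, coprime_mnm (wlm p) (wlm q)} ->
  ideal_gen s (a * q) -> ideal_gen s a.
Proof.
move=> gs s0 q0 co_q saq; have [r [sar red_r]] := wreduce a s0.
case: (eqVneq r 0) sar red_r => [->|r0] sar red_r; first by rewrite -(subr0 a).
case: red_r => [/eqP|red_r]; first by rewrite (negPf r0).
have srq : ideal_gen s (r * q).
  have -> : r * q = a * q - q * (a - r).
    by rewrite mulrBr ![q * _]mulrC opprB addrC subrK.
  by apply: ideal_genD => //; apply/ideal_genN/ideal_genM.
have [|p sp] := gs _ srq; first by rewrite mulf_neq0.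
rewrite wlmM // => /(coprime_mnm_le (co_q _ sp)) le_pr.
by have := red_r _ sp; rewrite le_pr.
Qed.

(* If [f = b + r q] with [b] in the ideal of [s] and [r] reduced modulo [s],
   the leading monomials of [b] and [r q] differ, so no cancellation occurs. *)
Lemma groebner_rcons s q : groebner s -> 0 \notin s -> q != 0 ->
  {in s, forall p, coprime_mnm (wlm p) (wlm q)} -> groebner (rcons s q).
Proof.
move=> gs s0 q0 co_q f /ideal_gen_rcons[a sfaq] f0.
have [r [sar red_r]] := wreduce a s0.
have [b bE] : exists b, b = f - r * q by exists (f - r * q).
have fE : f = b + r * q by rewrite bE subrK.
have sb : ideal_gen s b.
  have -> : b = (f - a * q) + q * (a - r).
    by rewrite bE mulrBr ![q * _]mulrC addrA subrK.
  by apply: ideal_genD => //; apply: ideal_genM.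
have fromb : b != 0 -> wlm f = wlm b ->
    exists2 p, p \in rcons s q & (wlm p <= wlm f)%MM.
  move=> b0 ->; have [p sp le_pb] := gs _ sb b0.
  by exists p; rewrite // mem_rcons inE sp orbT.
have [r0|r0] := eqVneq r 0.
  by move: fE; rewrite r0 mul0r addr0 => fb; apply: fromb; rewrite -fb.
case: red_r => [/eqP|red_r]; first by rewrite (negPf r0).
have fromq : wlm f = wlm (r * q) ->
    exists2 p, p \in rcons s q & (wlm p <= wlm f)%MM.
  move=> ->; exists q; first by rewrite mem_rcons mem_head.
  by rewrite wlmM // lem_addl.
have [b0|b0] := eqVneq b 0; first by apply: fromq; rewrite fE b0 add0r.
have neq_b : wlm b != wlm (r * q).
  have [p sp le_pb] := gs _ sb b0; apply: contraNneq (red_r _ sp) => eq_b.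
  by move: le_pb; rewrite eq_b wlmM // => /(coprime_mnm_le (co_q _ sp)).
by case: (wlmD_neq neq_b); rewrite -fE; [apply: fromb | apply: fromq].
Qed.

(** Buchberger's coprimality criterion, obtained by adding one generator at a time instead of
    through S-polynomials. *)
Lemma groebner_coprime s : 0 \notin s ->
  pairwise (fun p q => coprime_mnm (wlm p) (wlm q)) s ->
  groebner s.
Proof.
elim/last_ind: s => [_ _ f /ideal_gen_nil -> /eqP //|s q IH].
rewrite mem_rcons inE negb_or eq_sym pairwise_rcons.
move=> /andP[q0 s0] /andP[/allP co_q pw_s].
by apply: groebner_rcons => //; apply: IH.
Qed.

(** If the remainder [r] of [f] is nonzero, some squarefree [wlm p] divides the square of [wlm r],
    hence [wlm r] itself: a contradiction. *)
Lemma groebner_radical s f : groebner s -> 0 \notin s ->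
  {in s, forall p i, wlm p i <= 1}%N -> ideal_gen s (f * f) -> ideal_gen s f.
Proof.
move=> gs s0 sqf sff; have [r [sfr red_r]] := wreduce f s0.
case: (eqVneq r 0) sfr red_r => [->|r0] sfr red_r; first by rewrite -(subr0 f).
case: red_r => [/eqP|red_r]; first by rewrite (negPf r0).
have srr : ideal_gen s (r * r).
  have -> : r * r = f * f + - ((f + r) * (f - r)).
    by rewrite [_ * (f - r)]mulrC -subr_sqr !expr2 opprB addrC subrK.
  by apply: ideal_genD => //; apply/ideal_genN/ideal_genM.
have [|p sp /mnm_lepP le_p] := gs _ srr; first by rewrite mulf_neq0.
have /negP[] := red_r _ sp; apply/mnm_lepP => i; move: (le_p i).
rewrite wlmM // mnmDE; case: (wlm r i) => // k _.
exact: leq_trans (sqf _ sp i) _.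
Qed.

(** The last entry [q] is arbitrary: for [i < size s] the factor to cancel is [s]_i[, whatever]a[_j]
    is, and for [i = size s] both factors are [q]. *)
Lemma d_sequence_rcons s q : 0 \notin s ->
  pairwise (fun p q => coprime_mnm (wlm p) (wlm q)) s ->
  {in s, forall p i, wlm p i <= 1}%N -> d_sequence (rcons s q).
Proof.
move=> s0 pw_s sqf a i j; rewrite {}/a size_rcons ltnS.
move=> le_is /andP[lt_ij le_js] x.
rewrite /colon /= !ideal_gen_cons0; split=> sx; last first.
  by rewrite mulrCA; apply: ideal_genM.
have gs k : groebner (take k s).
  apply: groebner_coprime; first by apply: contra s0 => /mem_take.
  exact: subseq_pairwise (take_subseq _ _) pw_s.
have s0k k : 0 \notin take k s by apply: contra s0 => /mem_take.
move: sx; rewrite !nth_rcons -cats1 takel_cat //.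
have [lt_is sx|ge_is] := ltnP i (size s).
  apply: (@groebner_nzd _ s`_i) => //.
  - by apply: contraNneq s0 => <-; apply: mem_nth.
  - move: pw_s; rewrite -{1}(cat_take_drop i s) (drop_nth 0) // pairwise_cat.
    by case/andP=> /allrelP co _ p sp; apply: co; rewrite ?mem_head.
  - by rewrite -mulrA [_ * s`_i]mulrC.
have iE : i = size s by apply/eqP; rewrite eqn_leq le_is.
have jE : j = i.+1 by apply/eqP; rewrite eqn_leq lt_ij iE le_js.
rewrite jE iE /= take_size nth_cat ltnn subnn eqxx => sx.
apply: groebner_radical => //; first by rewrite -(take_size s).
by rewrite mulrACA -mulrA; apply: ideal_genM.
Qed.

End WeightedLeadingMonomials.

(** * Leading monomials of the entries of the product *)

Lemma mdeg_scaleU n (w : 'I_n -> nat) i : mdeg (scale w U_(i)) = (w i).+1.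
Proof.
rewrite mdegE (bigD1 i) //= big1 => [|j ji]; rewrite !mnmE.
  by rewrite eqxx muln1 addn0.
by rewrite eq_sym (negPf ji) muln0.
Qed.

Section GenericAlternatingLeads.
Variables (K : fieldType) (n : nat).

(* Indices count from 0, and [weigh] adds 1: x_(k,k+1) gets total weight k + 2
   and every other indeterminate 1. *)
Definition superdiag_weight (v : vars n) : nat :=
  if v is inl p then
    if (val p).2 == (val p).1.+1 :> nat then (val p).1.+1 else 0%N
  else 0%N.

Definition wt (i : 'I_#|vars n|) : nat := superdiag_weight (enum_val i).

Lemma mdeg_scale_rank v :
  mdeg (scale wt U_(enum_rank v)) = (superdiag_weight v).+1.
Proof. by rewrite mdeg_scaleU /wt enum_rankK. Qed.

Lemma msize_weigh_indet v :
  msize (weigh wt (indet K v)) = (superdiag_weight v).+2.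
Proof. by rewrite weighX msizeX mdeg_scale_rank. Qed.

Lemma xvarE (i j : 'I_n) (lt_ij : (i < j)%N) :
  xvar K i j = indet K (inl (exist _ (i, j) lt_ij)).
Proof.
rewrite /xvar; case: insubP => [p _ pE|]; last by rewrite /= lt_ij.
by congr (indet _ (inl _)); apply: val_inj.
Qed.

(** Since [msize] is degree plus one, this bounds the weight by k + 1, attained at the entry
    -x_(k-1,k). Weights increase along the superdiagonal so that x_(k,k+1), of weight k + 2, beats
    it. *)
Lemma msize_weigh_alt (k j : 'I_n) : j != k.+1 :> nat ->
  (msize (weigh wt (generic_alt_mx K n k j)) <= k.+2)%N.
Proof.
rewrite mxE => jk; case: ltngtP => [lt_kj|lt_jk|_].
- by rewrite (xvarE lt_kj) msize_weigh_indet /= (negPf jk).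
- rewrite (xvarE lt_jk) /weigh comp_mpolyN mmeasureN -/(weigh _ _).
  by rewrite msize_weigh_indet /=; case: ifP.
- by rewrite /weigh comp_mpoly0 msize0.
Qed.

Lemma wlm_g (k k' : 'I_n) (lt_k : (k < k')%N) : k' = k.+1 :> nat ->
  g K k != 0 /\
  wlm wt (g K k) =
    (U_(enum_rank (inl (exist _ (k, k') lt_k) : vars n))
     + U_(enum_rank (inr k' : vars n)))%MM.
Proof.
move=> k'E; set m := (_ + _)%MM.
set rest := \sum_(j < n | j != k') generic_alt_mx K n k j * generic_col K n j 0.
have gE : g K k = 'X_[m] + rest.
  by rewrite /g (bigD1 k') //= !mxE lt_k (xvarE lt_k) mpolyXD.
have deg_m : mdeg (scale wt m) = k.+3.
  by rewrite scaleD mdegD !mdeg_scale_rank /= k'E eqxx addn1.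
have size_rest : (msize (weigh wt rest) <= k.+3)%N.
  rewrite /weigh raddf_sum /= (leq_trans (mmeasure_sum _ _ _ _)) //.
  apply/bigmax_leqP => j jk'; rewrite -/(weigh _ _) weighM.
  have [->|M0] := eqVneq (weigh wt (generic_alt_mx K n k j)) 0.
    by rewrite mul0r msize0.
  have y0 : weigh wt (generic_col K n j 0) != 0.
    by rewrite mxE -msize_poly_eq0 msize_weigh_indet.
  rewrite msizeM // [generic_col _ _ _ _]mxE msize_weigh_indet /= addn2 ltnS.
  by apply: msize_weigh_alt; rewrite -k'E.
have lt_rest : (mlead (weigh wt rest) < mlead 'X_[K, scale wt m])%O.
  rewrite mleadXm; apply: lt_mdeg_ltmc; rewrite deg_m.
  have [->|r0] := eqVneq (weigh wt rest) 0; first by rewrite mlead0 mdeg0.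
  by rewrite mlead_deg.
have lead_g : mlead (weigh wt (g K k)) = scale wt m.
  rewrite gE /weigh comp_mpolyD -!/(weigh _ _) weighX mleadDl //.
  exact: mleadXm.
split; last by apply: (@scale_inj _ wt); rewrite -mlead_weigh.
(* The leading monomial has degree k + 3, whereas [mlead 0] has degree 0. *)
apply/eqP => g0; move: deg_m.
by rewrite -lead_g g0 /weigh comp_mpoly0 mlead0 mdeg0.
Qed.

End GenericAlternatingLeads.

Theorem theorem3p7 (K : fieldType) (n : nat) (hn : (3 <= n)%N) :
  d_sequence [seq g K k | k <- enum 'I_n].
Proof.
(* The last row has no superdiagonal entry; it supplies the arbitrary last element. *)
case: n hn => // n _; rewrite enum_ordSr map_rcons -map_comp.
have lead_g (k : 'I_n) : exists p : {p : 'I_n.+1 * 'I_n.+1 | (p.1 < p.2)%N},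
    [/\ (val p).1 = k :> nat, g K (widen_ord (leqnSn n) k) != 0
      & wlm (@wt n.+1) (g K (widen_ord (leqnSn n) k)) =
          (U_(enum_rank (inl p : vars n.+1))
           + U_(enum_rank (inr (lift ord0 k) : vars n.+1)))%MM].
  have lt_k : (widen_ord (leqnSn n) k < lift ord0 k)%N by [].
  have [|g0 gE] := @wlm_g K _ _ _ lt_k; first by [].
  by exists (exist _ (_, _) lt_k).
apply: (@d_sequence_rcons _ _ (@wt n.+1)).
- apply/mapP => -[k _ /esym/eqP]; have [p [_ /negPf gk0 _]] := lead_g k.
  by rewrite /= gk0.
- rewrite pairwise_map; have := enum_uniq 'I_n; rewrite uniq_pairwise.
  apply: sub_pairwise => k l /= neq_kl; apply/forallP => i.
  have [p [pk _ ->]] := lead_g k; have [q [ql _ ->]] := lead_g l.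
  rewrite !mnmE -(enum_valK i) !(inj_eq enum_rank_inj).
  (* A shared x_(k,k+1) or a shared y_(k+1) would each determine k. *)
  case: (enum_val i) => [r|j]; rewrite /= ?addn0 ?add0n !eqb0 -negb_and.
    apply: contra neq_kl => /andP[/eqP[<-] /eqP[pq]].
    by rewrite -val_eqE /= -pk -ql pq.
  apply: contra neq_kl => /andP[/eqP[<-] /eqP[lk]].
  exact/eqP/val_inj/esym/lk.
- move=> _ /mapP[k _ ->] i; have [p [_ _ ->]] := lead_g k.
  rewrite !mnmE -(enum_valK i) !(inj_eq enum_rank_inj).
  by case: (enum_val i) => v; rewrite /= ?addn0 ?add0n leq_b1.
Qed.
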